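(* Let $K$ be an arbitrary long virtual knot and let $D$ be a diagram of $K$ (identified with its based Gauss diagram). Then $V_{i(p(D))}$ is an invariant of the long virtual knot $K$; that is, if $D$ and $D'$ are two diagrams of the same long virtual knot, then $V_{i(p(D))}=V_{i(p(D'))}$.
   Context: All knots are oriented. A long virtual knot diagram is a generic immersion of the oriented line in the plane (standard outside a compact set; equivalently an oriented circle with a base point away from the double points), with finitely many transversal double points, each declared either a real crossing (with over/under information) or a virtual crossing. A long virtual knot is a class of such diagrams modulo planar isotopy, Reidemeister moves and virtual moves performed away from the base point. Closing the line (forgetting the base point) gives a virtual knot. The Gauss diagram of a (long) virtual knot diagram is the counterclockwise oriented circle (with base point in the long case) with one chord joining the two preimages of each real crossing; each chord carries the sign (local writhe) of the crossing and an arrow from the over-branch to the under-branch; virtual crossings are ignored. Gauss diagrams are considered up to orientation (and base point) preserving homeomorphism. A Gauss diagram determines a virtual diagram up to virtual moves, and long virtual knots are the same as based Gauss diagrams modulo the Gauss-diagram versions of the Reidemeister moves performed away from the base point. Map $p$: for a based Gauss diagram $G$, call the first endpoint of a chord the endpoint met first when travelling along the oriented circle from the base point. The diagram $p(G)$ is the based circle with the same chords, with signs and arrows removed, where each chord is labelled $a$ if either (its sign is $+$ and its arrow points from the first endpoint to the second) or (its sign is $-$ and its arrow points from the second endpoint to the first), and is labelled $b$ otherwise. Map $i$: for a based chord diagram with chords labelled $a$ or $b$, $i$ replaces each label $a$ by the sign $+$ and each label $b$ by the sign $-$, giving a based chord diagram whose chords carry signs but no arrows. Jones polynomial: for a virtual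 knot diagram $D$ with writhe $w(D)$ (number of positive minus number of negative real crossings), $$V_D(t)=(-A^3)^{-w(D)}\sum_{s}A^{\sigma(s)}(-A^2-A^{-2})^{|s|-1}\Big|_{A=t^{-1/4}},$$ where $s$ runs over states, i.e. assignments of a positive or negative marker to every real crossing ($\sigma(s)$ = number of positive minus number of negative markers) and $|s|$ is the number of circles after smoothing the real crossings accordingly, the positive marker being the Kauffman $A$-smoothing (so the orientation-respecting smoothing is the one given by the positive marker at a positive crossing and by the negative marker at a negative crossing). For a chord diagram $P$ with signs on chords but no arrows, $V_P$ denotes $V_G$ for any Gauss diagram $G$ obtained from $P$ by choosing arrows (and forgetting any base point); by a theorem of Turaev this does not depend on the choice of arrows. *)

(* Defs.v *)
From HB Require Import structures.
From mathcomp Require Import all_boot all_order all_algebra.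
From Stdlib Require Import Relation_Operators.

Set Implicit Arguments.
Unset Strict Implicit.
Unset Printing Implicit Defensive.

Import Order.TTheory GRing.Theory Num.Theory.

Local Open Scope ring_scope.

(* A based circle with labelled chords is encoded by the word of chord
   endpoints read along the oriented circle from the base point. A letter is a
   chord name together with the label of the chord, and each chord contributes
   exactly two letters, which carry the same label. Names only serve to match
   endpoints; diagrams are meant up to injective renaming (see [gauss_move]). *)
Definition chord_wf (L : eqType) (w : seq (nat * L)) : bool :=
  all (fun x => (count (fun y => y.1 == x.1) w == 2%N)
             && (count_mem x w == 2%N)) w.

Record chord_diagram (L : eqType) : Type := ChordDiagram {
  chord_word :> seq (nat * L);
  chord_wordP : chord_wf chord_word }.

Inductive ab_label : Type := La | Lb.

Definition ab_to_bool (l : ab_label) : bool := if l is La then true else false.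
Definition ab_of_bool (b : bool) : ab_label := if b then La else Lb.
Lemma ab_to_boolK : cancel ab_to_bool ab_of_bool. Proof. by case. Qed.
HB.instance Definition _ := Equality.copy ab_label (can_type ab_to_boolK).

(* Signs are booleans, [true] being +. In a Gauss diagram an endpoint is
   ((name, sign), over), with [true] at the tail of the arrow. *)
Definition endpoint : Type := ((nat * bool) * bool)%type.

Definition name (x : endpoint) : nat := x.1.1.
Definition positive (x : endpoint) : bool := x.1.2.
Definition is_over (x : endpoint) : bool := x.2.

Definition gauss_wf (w : seq endpoint) : bool :=
  chord_wf (map fst w) && all (fun x => (x.1, ~~ is_over x) \in w) w.

Record gauss_diagram : Type := GaussDiagram {
  gauss_word :> seq endpoint;
  gauss_wordP : gauss_wf gauss_word }.

(* Three strands, top over middle over bottom, bound a triangle. The crossings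
   top/middle, top/bottom, middle/bottom are a, b, c. The booleans ot, om, ob
   say whether the top strand meets a before b, the middle strand a before c,
   and the bottom strand b before c; d says whether the sides of the triangle
   in counterclockwise order are top, bottom, middle (rather than top, middle,
   bottom). If d holds, ot, ~~ om and ob say whether the top, middle and bottom
   strands run counterclockwise around the triangle; otherwise ~~ ot, om and
   ~~ ob do. A crossing is positive iff (over direction, under direction) is a
   positive frame, which yields the signs below. *)
Definition in_order (b : bool) (x y : endpoint) : seq endpoint :=
  if b then [:: x; y] else [:: y; x].

Definition triangle (a b c : nat) (d ot om ob : bool) : seq (seq endpoint) :=
  let ca := (a, d == (ot == om)) in
  let cb := (b, d == (ot == ob)) in
  let cc := (c, d == (om == ob)) in
  [:: in_order ot (ca, true) (cb, true);
      in_order om (ca, false) (cc, true);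
      in_order ob (cb, false) (cc, false)].

(* Moves performed away from the base point never wrap around the end of the
   word. The third move reverses the order of the two crossings on each of the
   three strands, which may occur along the line in any order. *)
Inductive gauss_move : seq endpoint -> seq endpoint -> Prop :=
| Renaming (f : nat -> nat) (w : seq endpoint) of injective f :
    gauss_move w [seq ((f (name x), positive x), is_over x) | x <- w]
| Reidemeister1 (u v : seq endpoint) (c : nat) (e o : bool) :
    gauss_move (u ++ v) (u ++ [:: ((c, e), o); ((c, e), ~~ o)] ++ v)
| Reidemeister2 (u v w : seq endpoint) (c d : nat) (e o same : bool) :
    gauss_move (u ++ v ++ w)
      (u ++ [:: ((c, e), o); ((d, ~~ e), o)]
         ++ v ++ in_order same ((c, e), ~~ o) ((d, ~~ e), ~~ o) ++ w)
| Reidemeister3 (u v w x p q r : seq endpoint)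
    (a b c : nat) (d ot om ob : bool)
    of perm_eq [:: p; q; r] (triangle a b c d ot om ob) :
    gauss_move (u ++ p ++ v ++ q ++ w ++ r ++ x)
      (u ++ rev p ++ v ++ rev q ++ w ++ rev r ++ x).

(* Both ends of every move are well-formed, which forces freshness of the
   chords created by a move and distinctness of the chords involved in it. *)
Definition same_long_virtual_knot : gauss_diagram -> gauss_diagram -> Prop :=
  clos_refl_sym_trans gauss_diagram
    (fun D D' : gauss_diagram => gauss_move D D').

Definition first_endpoint (w : seq endpoint) (x : endpoint) : endpoint :=
  nth x w (find (fun y => name y == name x) w).

Definition p_label (w : seq endpoint) (x : endpoint) : ab_label :=
  let first_to_second := is_over (first_endpoint w x) in
  if (positive x && first_to_second) || (~~ positive x && ~~ first_to_second)
  then La else Lb.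

Definition p_word (w : seq endpoint) : seq (nat * ab_label) :=
  [seq (name x, p_label w x) | x <- w].

Definition i_label (l : ab_label) : bool :=
  match l with La => true | Lb => false end.

Definition i_word (w : seq (nat * ab_label)) : seq (nat * bool) :=
  [seq (x.1, i_label x.2) | x <- w].

Lemma chord_wf_relabel (L M : eqType) (g : nat * L -> M) (w : seq (nat * L)) :
  chord_wf w -> chord_wf [seq (x.1, g x) | x <- w].
Proof.
move=> /allP wf; apply/allP => _ /mapP[x xw ->] /=.
have /andP[/eqP nx /eqP cx] := wf x xw.
rewrite !count_map /=; apply/andP; split; first by apply/eqP.
rewrite eqn_leq -[X in (_ <= X)%N && _]nx -[X in _ && (X <= _)%N]cx.
apply/andP; split; last by apply: sub_count => y /= /eqP->.
by apply: sub_count => y /=; rewrite xpair_eqE => /andP[].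
Qed.

Lemma p_word_wf (D : gauss_diagram) : chord_wf (p_word D).
Proof.
have /andP[wf _] := gauss_wordP D.
pose g (z : nat * bool) := p_label D (z, true).
suff -> : p_word D = [seq (z.1, g z) | z <- map fst D].
  exact: chord_wf_relabel.
rewrite -map_comp; apply/eq_in_map => x xD /=; congr pair.
rewrite /g /p_label /first_endpoint.
have hx : has (fun y => name y == name x) D by apply/hasP; exists x.
rewrite -[find (fun y => name y == name (x.1, true)) D]
  /(find (fun y => name y == name x) D).
by rewrite (set_nth_default (x.1, true)) // -has_find.
Qed.

Lemma i_word_wf (P : chord_diagram ab_label) : chord_wf (i_word P).
Proof. exact/chord_wf_relabel/chord_wordP. Qed.

Lemma arrowless_wf (G : gauss_diagram) : chord_wf (map fst G).
Proof. by have /andP[] := gauss_wordP G. Qed.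

Definition map_p (D : gauss_diagram) : chord_diagram ab_label :=
  ChordDiagram (p_word_wf D).

Definition map_i (P : chord_diagram ab_label) : chord_diagram bool :=
  ChordDiagram (i_word_wf P).

Definition forget_arrows (G : gauss_diagram) : chord_diagram bool :=
  ChordDiagram (arrowless_wf G).

Lemma arrows_exist (P : chord_diagram bool) :
  exists G : gauss_diagram, forget_arrows G = P.
Proof.
case: P => w wf; pose e0 : nat * bool := (0%N, true).
pose g k : endpoint := (nth e0 w k, index (nth e0 w k) w == k).
pose gw : seq endpoint := map g (iota 0 (size w)).
have fgw : map fst gw = w.
  rewrite -map_comp -[RHS](mkseq_nth e0); exact: eq_map.
have gwf : gauss_wf gw.
  rewrite /gauss_wf fgw wf /=; apply/allP => _ /mapP[k kw ->].
  rewrite mem_iota /= add0n in kw; rewrite /g /is_over /=.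
  set e := nth e0 w k; have ew : e \in w by rewrite mem_nth.
  have iw : (index e w < size w)%N by rewrite index_mem.
  have [_|ne] := boolP (index e w == k); last first.
    apply/mapP; exists (index e w); first by rewrite mem_iota.
    by rewrite /g nth_index // eqxx.
  have /andP[_ /eqP c2] := allP wf _ ew.
  have ed : e \in drop (index e w).+1 w.
    move: c2; rewrite -{1}(cat_take_drop (index e w) w) count_cat.
    rewrite (drop_nth e0) // nth_index //= eqxx.
    rewrite (count_memPn _) ?add0n; last first.
      by rewrite in_take_leq ?ltnn // ltnW.
    by rewrite -has_pred1 has_count; case; rewrite ?add0n => ->.
  pose l := ((index e w).+1 + index e (drop (index e w).+1 w))%N.
  have lw : (l < size w)%N.
    by rewrite -ltn_subRL -size_drop index_mem.
  have nl : nth e0 w l = e by rewrite /l -nth_drop nth_index.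
  apply/mapP; exists l; first by rewrite mem_iota.
  by rewrite /g nl ltn_eqF // /l addSn ltnS leq_addr.
exists (GaussDiagram gwf); rewrite /forget_arrows.
move: (arrowless_wf _) => /=; rewrite fgw => wf'.
by congr ChordDiagram; exact: bool_irrelevance.
Qed.

Section Jones.

Variable G : gauss_diagram.

(* A crossing is a pair (name, sign). *)
Definition crossing : finType := seq_sub (map fst G).

Definition crossing_sign (c : crossing) : bool := (val c).2.

Definition crossing_at (k : 'I_(size G)) : nat * bool :=
  (tnth (in_tuple G) k).1.

(* A state maps a crossing to [true] for the positive marker. *)
Definition state : finType := {ffun crossing -> bool}.

Definition pm (b : bool) : int := if b then 1 else -1.

Definition writhe : int := \sum_(c : crossing) pm (crossing_sign c).

Definition sigma (s : state) : int := \sum_(c : crossing) pm (s c).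

(* The circle, cut at the base point and at the endpoints 0, ..., size G - 1,
   falls into arcs 0, ..., size G, arc k entering endpoint k and arc k + 1
   leaving it. The arcs 0 and size G are glued back at the base point. A
   smoothing at a crossing with endpoints k and l glues each entering arc to
   the arc leaving the other endpoint if it respects orientations; otherwise it
   glues the two entering arcs together and the two leaving arcs together. *)
Definition gauss_arc : finType := 'I_(size G).+1.

Definition glued_at (oriented : bool) (k l : nat) (x y : gauss_arc) : bool :=
  if oriented then (val x == k) && (val y == l.+1)
  else (val x == k) && (val y == l) || (val x == k.+1) && (val y == l.+1).

Definition glued (s : state) (x y : gauss_arc) : bool :=
  (x == ord0) && (y == ord_max)
  || [exists c : crossing, exists k : 'I_(size G), exists l : 'I_(size G),
       [&& k != l, crossing_at k == val c, crossing_at l == val c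
         & glued_at (s c == crossing_sign c) k l x y]].

Definition circles (s : state) : nat :=
  n_comp [rel x y | glued s x y || glued s y x] predT.

(* Rational functions in t^(1/4), so that t^(1/4) is the indeterminate. *)
Definition A : {fraction {poly int}} := (tofrac 'X)^-1.

(* The base point plays no role in the value, up to the choice of the place
   where the circle is cut: this is the polynomial of the closure of G. *)
Definition jones : {fraction {poly int}} :=
  (- A ^+ 3) ^ (- writhe)
  * \sum_(s : state) A ^ sigma s * (- A ^+ 2 - A ^- 2) ^+ (circles s).-1.

End Jones.

(* Main.v *)
(* Changing the crossings of the based diagram so that it becomes descending
   (every chord first met along its upper strand) turns the sign of a chord into
   + exactly when its label is a. So i o p forgets the arrows of the descending
   diagram. A Reidemeister move of D induces the same kind of move on the
   descending diagram, since a third move does not affect which strand of a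
   crossing comes first, and the Jones polynomial of an arrowless diagram is
   invariant under these moves by Kauffman's argument.

   The number of circles of a state is computed from the colourings of the arcs
   by two colours which are constant along circles: there are 2 ^ (circles - 1)
   of them with a given colour at the base point. Such colourings can be summed
   along the word, so that the part of a diagram affected by a move enters only
   through the number of its colourings with prescribed colours at the ends. *)
From mathcomp Require Import all_boot all_order all_algebra.
From mathcomp Require Import ring zify.
Require Import Defs.

Set Implicit Arguments.
Unset Strict Implicit.
Unset Printing Implicit Defensive.

Import Order.TTheory GRing.Theory Num.Theory.

(** * Colourings of arcs *)

Section Colourings.

Variable L : eqType.
Implicit Types (w u v : seq L) (t : seq (L * (bool * bool))) (o : L -> bool).
Implicit Types (b e : bool).

(** A letter carries the colours of its entering and leaving arcs. The smoothing that respects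
    orientations joins entering arcs to leaving ones; the other joins the two entering arcs and the
    two leaving arcs. *)
Definition compatible b (x y : bool * bool) : bool :=
  if b then (x.1 == y.2) && (x.2 == y.1) else (x.1 == y.1) && (x.2 == y.2).

Definition matched o (x y : L * (bool * bool)) : bool :=
  (x.1 == y.1) ==> compatible (o x.1) x.2 y.2.

Definition admissible o t : bool := pairwise (matched o) t.

(* Sums [F] over the colourings of the arcs of [w] starting with colour [b];
   [F] receives the letters with the colours of their entering and leaving
   arcs, and the colour of the last arc. *)
Fixpoint colour_sum w b (F : seq (L * (bool * bool)) -> bool -> nat) : nat :=
  if w is x :: w' then
    colour_sum w' false (fun t => F ((x, (b, false)) :: t))
    + colour_sum w' true (fun t => F ((x, (b, true)) :: t))
  else F [::] b.

(** The gluing at the base point forces the last arc to have the colour of the first, here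
    [false]. *)
Definition colourings o w : nat :=
  colour_sum w false (fun t e => (~~ e && admissible o t : nat)).

Lemma matched_sym o : symmetric (matched o).
Proof.
move=> [x [x1 x2]] [y [y1 y2]]; rewrite /matched /= [y == x]eq_sym.
case: eqP => //= ->; rewrite /compatible /=.
by case: (o y) x1 x2 y1 y2 => [] [] [] [] [].
Qed.

Lemma admissible_perm o t1 t2 :
  perm_eq t1 t2 -> admissible o t1 = admissible o t2.
Proof.
have sub t t' : perm_eq t t' -> admissible o t -> admissible o t'.
  elim: t t' => [|x t IH] t'; first by rewrite perm_sym => /perm_nilP->.
  move=> e; have xt' : x \in t' by rewrite -(perm_mem e) mem_head.
  case/splitPr: t' / xt' e => p1 p2 e.
  have {}e : perm_eq t (p1 ++ p2).
    by move: e; rewrite perm_sym -cat1s perm_catCA /= perm_cons perm_sym.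
  rewrite /admissible /= => /andP[xt /(IH _ e)]; move: xt.
  rewrite (perm_all _ e) all_cat => /andP[x1 x2].
  rewrite /admissible !pairwise_cat /= allrel_consr => /and3P[-> -> ->].
  rewrite x2 !andbT /=; apply: sub_all x1 => y; by rewrite matched_sym.
by move=> e; apply/idP/idP; apply: sub => //; rewrite perm_sym.
Qed.

(** Endpoints of different crossings do not constrain each other. *)
Lemma admissible_cat o t1 t2 :
  {in map fst t1, forall x, x \notin map fst t2} ->
  admissible o (t1 ++ t2) = admissible o t1 && admissible o t2.
Proof.
move=> dis; rewrite /admissible pairwise_cat.
suff -> : allrel (matched o) t1 t2 by [].
apply/allrelP=> x y xt yt; rewrite /matched; case: eqP => // exy.
by case/negP: (dis _ (map_f _ xt)); rewrite exy map_f.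
Qed.

Lemma admissible_ext o o' t :
  {in map fst t, o =1 o'} -> admissible o t = admissible o' t.
Proof.
move=> eo; apply: (@eq_in_pairwise _ [in t]); last exact/allP.
by move=> x y xt _; rewrite /matched eo ?map_f.
Qed.

Lemma colour_sum_cat u v b F :
  colour_sum (u ++ v) b F =
  colour_sum u b (fun t e => colour_sum v e (fun t' => F (t ++ t'))).
Proof. by elim: u b F => //= x u IH b F; rewrite !IH. Qed.

Lemma eq_colour_sum w b F F' :
  (forall t e, map fst t = w -> F t e = F' t e) ->
  colour_sum w b F = colour_sum w b F'.
Proof.
elim: w b F F' => /= [|x w IH] b F F' eF; first exact: eF.
by congr addn; apply: IH => t e tw; rewrite eF //= tw.
Qed.

Lemma colour_sumD w b F F' :
  colour_sum w b (fun t e => F t e + F' t e) =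
  colour_sum w b F + colour_sum w b F'.
Proof. by elim: w b F F' => //= x w IH b F F'; rewrite !IH addnACA. Qed.

Lemma colour_sumM k w b F :
  colour_sum w b (fun t e => k * F t e) = k * colour_sum w b F.
Proof. by elim: w b F => //= x w IH b F; rewrite !IH mulnDr. Qed.

Lemma exchange_colour_sum u v b b' F :
  colour_sum u b (fun t e => colour_sum v b' (F t e)) =
  colour_sum v b' (fun t' e' => colour_sum u b (fun t e => F t e t' e')).
Proof. by elim: u b F => //= x u IH b F; rewrite !IH -colour_sumD. Qed.

Lemma colour_sum_last w b F :
  colour_sum w b F =
  colour_sum w b (fun t e => (e == false) * F t false)
  + colour_sum w b (fun t e => (e == true) * F t true).
Proof.
rewrite -colour_sumD; apply: eq_colour_sum => t e _.
by case: e; rewrite mul0n mul1n ?addn0.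
Qed.

(** The constant colouring is always admissible. Positivity makes [logn 2] grow by one when a count
    is doubled. *)
Lemma colourings_gt0 o w : 0 < colourings o w.
Proof.
rewrite /colourings; set F := fun _ _ => _.
pose c := [seq (x, (false, false)) | x <- w].
have : 0 < F c false.
  suff ac : admissible o c by rewrite /F ac.
  rewrite /admissible pairwise_map; elim: w {c F} => //= x w ->; rewrite andbT.
  by apply/allP=> y _; rewrite /matched /=; case: eqP => //= _; case: (o x).
rewrite {}/c; move: F; elim: w => //= x w IH F F0.
by rewrite ltn_addr // IH.
Qed.

(* The count of a word with three strands P, Q, R cut out; the strands enter
   through the number [g] of their colourings with prescribed end colours. *)
Definition ends := bool -> bool -> bool -> bool -> bool -> bool -> nat.

Definition cut_colourings o u v w x (g : ends) : nat :=
  colour_sum u false (fun tu i1 => \sum_(e1 : bool)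
  colour_sum v e1 (fun tv i2 => \sum_(e2 : bool)
  colour_sum w e2 (fun tw i3 => \sum_(e3 : bool)
  colour_sum x e3 (fun tx e =>
    (~~ e && admissible o (tu ++ tv ++ tw ++ tx)) * g i1 e1 i2 e2 i3 e3)))).

Definition strand_colourings o P Q R : ends := fun i1 e1 i2 e2 i3 e3 =>
  colour_sum P i1 (fun tp e => (e == e1) *
  colour_sum Q i2 (fun tq e => (e == e2) *
  colour_sum R i3 (fun tr e => (e == e3) * admissible o (tp ++ tq ++ tr)))).

Lemma eq_cut o o' u v w x (g g' : ends) :
  {in u ++ v ++ w ++ x, o =1 o'} ->
  (forall i1 e1 i2 e2 i3 e3, g i1 e1 i2 e2 i3 e3 = g' i1 e1 i2 e2 i3 e3) ->
  cut_colourings o u v w x g = cut_colourings o' u v w x g'.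
Proof.
move=> eo eg; apply: eq_colour_sum => tu i1 eu; apply: eq_bigr => e1 _.
apply: eq_colour_sum => tv i2 ev; apply: eq_bigr => e2 _.
apply: eq_colour_sum => tw i3 ew; apply: eq_bigr => e3 _.
apply: eq_colour_sum => tx e ex; rewrite eg (@admissible_ext o o') //.
by rewrite !map_cat eu ev ew ex.
Qed.

Lemma cutM k o u v w x (g : ends) :
  cut_colourings o u v w x
    (fun i1 e1 i2 e2 i3 e3 => k * g i1 e1 i2 e2 i3 e3) =
  k * cut_colourings o u v w x g.
Proof.
rewrite /cut_colourings -colour_sumM; apply: eq_colour_sum => tu i1 _.
rewrite big_distrr; apply: eq_bigr => e1 _ /=.
rewrite -colour_sumM; apply: eq_colour_sum => tv i2 _.
rewrite big_distrr; apply: eq_bigr => e2 _ /=.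
rewrite -colour_sumM; apply: eq_colour_sum => tw i3 _.
rewrite big_distrr; apply: eq_bigr => e3 _ /=.
by rewrite -colour_sumM; apply: eq_colour_sum => tx e _; rewrite mulnCA.
Qed.

(** Once the colour [e1] at the end of the strand [P] is fixed, what follows can be coloured first,
    which moves [P] to the innermost sum. *)
Lemma colour_sum_strand P u i F :
  colour_sum P i (fun tp e => colour_sum u e (F tp)) =
  \sum_(e1 : bool) colour_sum u e1 (fun tu e => 
     colour_sum P i (fun tp e' => (e' == e1) * F tp tu e)).
Proof.
rewrite colour_sum_last big_bool addnC; congr addn;
  by under eq_colour_sum => t e _ do rewrite -colour_sumM;
    rewrite exchange_colour_sum.
Qed.

Lemma strand_colouringsCA o P Q R i1 e1 i2 e2 i3 e3 :
  strand_colourings o P Q R i1 e1 i2 e2 i3 e3 =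
  strand_colourings o Q P R i2 e2 i1 e1 i3 e3.
Proof.
rewrite /strand_colourings.
under eq_colour_sum => tp e _ do rewrite -colour_sumM.
rewrite exchange_colour_sum; apply: eq_colour_sum => tq e _.
rewrite -colour_sumM; apply: eq_colour_sum => tp e' _.
rewrite mulnCA; congr (_ * (_ * _)); apply: eq_colour_sum => tr e'' _.
congr (_ * nat_of_bool _); apply: admissible_perm.
by rewrite perm_catCA.
Qed.

Lemma strand_colouringsAC o P Q R i1 e1 i2 e2 i3 e3 :
  strand_colourings o P Q R i1 e1 i2 e2 i3 e3 =
  strand_colourings o P R Q i1 e1 i3 e3 i2 e2.
Proof.
apply: eq_colour_sum => tp e _; congr muln.
under eq_colour_sum => tq e' _ do rewrite -colour_sumM.
rewrite exchange_colour_sum; apply: eq_colour_sum => tr e' _.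
rewrite -colour_sumM; apply: eq_colour_sum => tq e'' _.
rewrite mulnCA; congr (_ * (_ * nat_of_bool _)); apply: admissible_perm.
by rewrite perm_cat2l perm_catC.
Qed.

(** The letters of the strands occur nowhere else, so admissibility splits into a condition on the
    strands and one on the rest, linked only by the end colours. *)
Lemma colourings_cut o u v w x P Q R :
  {in P ++ Q ++ R, forall c, c \notin u ++ v ++ w ++ x} ->
  colourings o (u ++ P ++ v ++ Q ++ w ++ R ++ x) =
  cut_colourings o u v w x (strand_colourings o P Q R).
Proof.
move=> dis; rewrite /colourings /cut_colourings colour_sum_cat.
apply: eq_colour_sum => tu i1 eu.
rewrite colour_sum_cat colour_sum_strand; apply: eq_bigr => e1 _.
rewrite colour_sum_cat; apply: eq_colour_sum => tv i2 ev.
rewrite colour_sum_cat colour_sum_strand; apply: eq_bigr => e2 _.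
rewrite colour_sum_cat; apply: eq_colour_sum => tw i3 ew.
rewrite colour_sum_cat colour_sum_strand; apply: eq_bigr => e3 _.
apply: eq_colour_sum => tx e ex.
(* The strands have been pushed inwards one after the other, so their sums are nested in the order
   [R], [Q], [P]. *)
rewrite strand_colouringsAC strand_colouringsCA strand_colouringsAC.
rewrite -colour_sumM; apply: eq_colour_sum => tr e' er; rewrite mulnCA.
congr muln; rewrite -colour_sumM; apply: eq_colour_sum => tq e'' eq.
rewrite mulnCA; congr muln; rewrite -colour_sumM.
apply: eq_colour_sum => tp e''' ep; rewrite mulnCA; congr muln.
rewrite mulnb -andbA; congr (nat_of_bool (_ && _)); rewrite andbC.
rewrite -admissible_cat; last first.
  rewrite !map_cat ep eq er eu ev ew ex => c.
  move=> cr; apply: dis; move: cr; rewrite !mem_cat.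
  by case/or3P=> ->; rewrite ?orbT.
by apply: admissible_perm; apply/permP=> a; rewrite !count_cat; lia.
Qed.

End Colourings.

Lemma colour_sum_map (L M : eqType) (h : L -> M) w b F :
  colour_sum (map h w) b F =
  colour_sum w b (fun t => F [seq (h x.1, x.2) | x <- t]).
Proof. by elim: w b F => //= x w IH b F; rewrite !IH. Qed.

Lemma colourings_map (L M : eqType) (h : L -> M) o w :
  {in w &, injective h} -> colourings o (map h w) = colourings (o \o h) w.
Proof.
move=> hi; rewrite /colourings colour_sum_map; apply: eq_colour_sum => t e tw.
rewrite /admissible pairwise_map; congr (nat_of_bool (_ && _)).
apply: (@eq_in_pairwise _ [in t]); last exact/allP.
move=> x y xt yt; rewrite /matched /=.
by rewrite (inj_in_eq hi) // -tw map_f.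
Qed.

(** * State sums *)

Definition update (T : eqType) (s : T -> bool) (c : T) (b : bool) : T -> bool :=
  fun x => if x == c then b else s x.

Lemma update_id (T : eqType) (s : T -> bool) c b : update s c b c = b.
Proof. by rewrite /update eqxx. Qed.

Lemma update_notin (T : eqType) (s : T -> bool) c b (w : seq T) :
  c \notin w -> {in w, update s c b =1 s}.
Proof. by move=> cw x xw; rewrite /update; case: eqP xw cw => // -> ->. Qed.

Section StateSum.

Local Open Scope ring_scope.

Variables (K : fieldType) (A : K).

(** States are functions compared pointwise; updates made in different orders agree in this
    sense. *)
Definition extensional T (Phi : (T -> bool) -> K) :=
  forall s s', s =1 s' -> Phi s = Phi s'.

Section Generic.

Variable T : eqType.
Implicit Types (C D : seq T) (Phi : (T -> bool) -> K) (s : T -> bool).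

(* Sums [Phi] over the states which differ from [s] only on [C], with the
   weights [A] for positive and [A^-1] for negative markers. *)
Fixpoint state_sum C Phi s : K :=
  if C is c :: C' then
    A * state_sum C' Phi (update s c true)
    + A^-1 * state_sum C' Phi (update s c false)
  else Phi s.

Lemma eq_state_sum C Phi Phi' s :
  Phi =1 Phi' -> state_sum C Phi s = state_sum C Phi' s.
Proof. by move=> e; elim: C s => //= c C IH s; rewrite !IH. Qed.

Lemma state_sum_extensional C Phi :
  extensional Phi -> extensional (state_sum C Phi).
Proof.
move=> ext; elim: C => //= c C IH s s' e.
by congr (_ * _ + _ * _); apply: IH => x; rewrite /update e.
Qed.

Lemma state_sum_cat C D Phi s :
  state_sum (C ++ D) Phi s = state_sum C (state_sum D Phi) s.
Proof. by elim: C s => //= c C IH s; rewrite !IH. Qed.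

Lemma state_sumZ k C Phi s :
  state_sum C (fun s => k * Phi s) s = k * state_sum C Phi s.
Proof. by elim: C s => //= c C IH s; rewrite !IH; ring. Qed.

Lemma state_sum_swap c d C Phi s : extensional Phi -> c != d ->
  state_sum (c :: d :: C) Phi s = state_sum (d :: c :: C) Phi s.
Proof.
move=> ext ncd /=.
have sw b b' : state_sum C Phi (update (update s c b) d b')
             = state_sum C Phi (update (update s d b') c b).
  apply: state_sum_extensional => // x; rewrite /update.
  by case: eqP => // ->; rewrite eq_sym (negbTE ncd).
rewrite !sw; ring.
Qed.

(** By induction on [C]: its head is carried through the letters preceding it in [D], and uniqueness
    makes each swap one of distinct letters. *)
Lemma state_sum_perm C D Phi s : extensional Phi -> uniq C -> perm_eq C D ->
  state_sum C Phi s = state_sum D Phi s.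
Proof.
move=> ext; elim: C D s => [|c C IH] D s.
  by rewrite perm_sym => _ /perm_nilP ->.
move=> /= /andP[cC uC] e; have cD : c \in D by rewrite -(perm_mem e) mem_head.
case/splitPr: D / cD e => D1 D2 e.
have {}e : perm_eq C (D1 ++ D2).
  by move: e; rewrite perm_sym -cat1s perm_catCA /= perm_cons perm_sym.
have cD1 : c \notin D1.
  by apply: contra cC => cD1; rewrite (perm_mem e) mem_cat cD1.
rewrite !(IH _ _ uC e) -[LHS]/(state_sum (c :: D1 ++ D2) Phi s).
elim: D1 cD1 s {e} => //= d D1 IH1; rewrite inE negb_or => /andP[ncd cD1] s.
rewrite -!IH1 //.
exact: (state_sum_swap (D1 ++ D2) s ext ncd).
Qed.

End Generic.

Lemma state_sum_map (T U : eqType) (h : T -> U) C (Phi : (T -> bool) -> K) s :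
  injective h -> extensional Phi ->
  state_sum (map h C) (fun s => Phi (s \o h)) s = state_sum C Phi (s \o h).
Proof.
move=> hi ext; elim: C s => //= c C IH s; rewrite !IH.
congr (_ * _ + _ * _); apply: state_sum_extensional => // x;
  by rewrite /update /= inj_eq.
Qed.

End StateSum.

(** * The state sum of an arrowless word *)

Section WordJones.

Local Open Scope ring_scope.

Variables (K : fieldType) (A : K).
Hypothesis A0 : A != 0.

Local Notation letter := (nat * bool)%type.
Implicit Types (u v w x : seq letter) (s : letter -> bool).

Definition orientation s : letter -> bool := fun c => s c == c.2.

(* The number of colourings with base colour [false] is a power of two, whose
   exponent is the number of circles other than the base one. *)
Definition loop_value (n : nat) : K := (- A ^+ 2 - A ^- 2) ^+ logn 2 n.

Definition state_value w s : K := loop_value (colourings (orientation s) w).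

(** A crossing appears in the word at both of its endpoints; [undup] counts it once. *)
Definition word_writhe w : int := \sum_(c <- undup w) pm c.2.

Definition word_jones w : K :=
  (- A ^+ 3) ^ (- word_writhe w)
  * state_sum A (undup w) (state_value w) (fun=> true).

Lemma loop_value_double n : (0 < n)%N ->
  loop_value (2 * n) = (- A ^+ 2 - A ^- 2) * loop_value n.
Proof.
by move=> n0; rewrite /loop_value lognM // logn_prime // eqxx add1n exprS.
Qed.

Lemma eq_colourings (o o' : letter -> bool) w :
  {in w, o =1 o'} -> colourings o w = colourings o' w.
Proof.
move=> e; apply: eq_colour_sum => t b tw.
by rewrite (@admissible_ext _ o o') // tw.
Qed.

Lemma eq_state_value w s s' :
  {in w, s =1 s'} -> state_value w s = state_value w s'.
Proof.
move=> e; rewrite /state_value.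
rewrite (@eq_colourings (orientation s) (orientation s')) // => c cw.
by rewrite /orientation e.
Qed.

Lemma state_value_extensional w : extensional (state_value w).
Proof. by move=> s s' e; apply: eq_state_value => c _; apply: e. Qed.

Lemma word_jones_map (f : nat -> nat) w : injective f ->
  word_jones [seq (f c.1, c.2) | c <- w] = word_jones w.
Proof.
move=> fi; pose h (c : letter) := (f c.1, c.2).
have hi : injective h by move=> [c e] [c' e'] [/fi -> ->].
rewrite /word_jones /word_writhe -/h !(undup_map_inj hi) big_map /=.
congr (_ * _).
have ext := @state_value_extensional w.
rewrite -(state_sum_map A (undup w) (fun=> true) hi ext).
apply: eq_state_sum => s; rewrite /state_value colourings_map //.
exact: in2W.
Qed.

(** The crossings in [D], away from the move, contribute equally to both words. Summing over them
    last leaves a comparison of the sums over [C] and [C'] with the markers on [D] fixed. *)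
Lemma word_jones_local C C' w w' D :
  perm_eq (undup w) (D ++ C) -> perm_eq (undup w') (D ++ C') ->
  (forall s, (- A ^+ 3) ^ (- \sum_(c <- C) pm c.2)
               * state_sum A C (state_value w) s
   = (- A ^+ 3) ^ (- \sum_(c <- C') pm c.2)
       * state_sum A C' (state_value w') s) ->
  word_jones w = word_jones w'.
Proof.
move=> e e' loc; rewrite /word_jones /word_writhe.
rewrite (perm_big _ e) (perm_big _ e') /= !big_cat /= !opprD.
have ext := state_value_extensional.
rewrite (state_sum_perm A _ (@ext w) (undup_uniq w) e).
rewrite (state_sum_perm A _ (@ext w') (undup_uniq w') e').
have nz : - A ^+ 3 != 0 by rewrite oppr_eq0 expf_neq0.
rewrite !expfzDr // -!mulrA !state_sum_cat -!state_sumZ.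
by apply: eq_state_sum => s; rewrite loc.
Qed.

End WordJones.

(** * Strands cut out of a word *)

Section Strands.

Variable L : eqType.
Implicit Types (o : L -> bool) (u v w x T M B : seq L).

(** Reduces strands with arbitrary letters to strands with letters 0, 1, 2, for which the facts
    about bigons and triangles are finite computations. *)
Lemma strand_colourings_map (L' : eqType) (h : L -> L') (o' : L' -> bool) o
    P Q R i1 e1 i2 e2 i3 e3 :
  {in P ++ Q ++ R &, injective h} -> {in P ++ Q ++ R, o' \o h =1 o} ->
  strand_colourings o' (map h P) (map h Q) (map h R) i1 e1 i2 e2 i3 e3 =
  strand_colourings o P Q R i1 e1 i2 e2 i3 e3.
Proof.
move=> hi ho; rewrite /strand_colourings colour_sum_map.
apply: eq_colour_sum => tp e ep; congr muln; rewrite colour_sum_map.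
apply: eq_colour_sum => tq e' eq; congr muln; rewrite colour_sum_map.
apply: eq_colour_sum => tr e'' er; congr (_ * nat_of_bool _).
rewrite -!map_cat /admissible pairwise_map; set t := _ ++ _.
have et : map fst t = P ++ Q ++ R by rewrite !map_cat ep eq er.
apply: (@eq_in_pairwise _ [in t]); last exact/allP.
move=> x y xt yt; rewrite /matched /= (inj_in_eq hi) -?et ?map_f //.
by rewrite [o' _]ho // -et map_f.
Qed.

(* [pl] inserts three strands, in some order, into a word whose other letters
   are those of [ctx]. *)
Definition placement (pl : seq L -> seq L -> seq L -> seq L) ctx : Prop :=
  (forall T M B, perm_eq (pl T M B) (T ++ M ++ B ++ ctx)) /\
  (forall o1 o2 k T M B T' M' B',
    {in T ++ M ++ B, forall c, c \notin ctx} ->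
    {in T' ++ M' ++ B', forall c, c \notin ctx} ->
    {in ctx, o1 =1 o2} ->
    (forall i1 e1 i2 e2 i3 e3,
       strand_colourings o1 T M B i1 e1 i2 e2 i3 e3
       = k * strand_colourings o2 T' M' B' i1 e1 i2 e2 i3 e3) ->
    colourings o1 (pl T M B) = k * colourings o2 (pl T' M' B')).

Lemma placement_id u v w x :
  placement (fun T M B => u ++ T ++ v ++ M ++ w ++ B ++ x) (u ++ v ++ w ++ x).
Proof.
split=> [T M B|o1 o2 k T M B T' M' B' d d' eo eT].
  by apply/permP=> a; rewrite !count_cat; lia.
by rewrite !colourings_cut // -cutM; apply: eq_cut.
Qed.

(** Swaps of neighbouring strands generate all orders of three strands, so one placement yields the
    other five. *)
Lemma placementCA pl ctx :
  placement pl ctx -> placement (fun T M B => pl M T B) ctx.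
Proof.
case=> perm cut; split=> [T M B|o1 o2 k T M B T' M' B' d d' eo eT].
  by rewrite (permPl (perm M T B)) perm_catCA.
apply: cut => // [c|c|i1 e1 i2 e2 i3 e3].
- by move=> cT; apply: d; rewrite !mem_cat orbCA -!mem_cat.
- by move=> cT; apply: d'; rewrite !mem_cat orbCA -!mem_cat.
by rewrite strand_colouringsCA eT strand_colouringsCA.
Qed.

Lemma placementAC pl ctx :
  placement pl ctx -> placement (fun T M B => pl T B M) ctx.
Proof.
case=> perm cut; split=> [T M B|o1 o2 k T M B T' M' B' d d' eo eT].
  by rewrite (permPl (perm T B M)) perm_cat2l perm_catCA.
apply: cut => // [c|c|i1 e1 i2 e2 i3 e3].
- by rewrite !mem_cat => cT; apply: d; rewrite !mem_cat [(_ \in M) || _]orbC.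
- by rewrite !mem_cat => cT; apply: d'; rewrite !mem_cat [(_ \in M') || _]orbC.
by rewrite strand_colouringsAC eT strand_colouringsAC.
Qed.

Definition ordered (b : bool) (x y : L) : seq L :=
  if b then [:: x; y] else [:: y; x].

End Strands.

(** The smoothing of a kink that respects orientations splits off a circle, whose two colours double
    the count; the other leaves a plain strand. *)
Lemma kink_strands (L : eqType) (o o' : L -> bool) x i1 e1 i2 e2 i3 e3 :
  strand_colourings o [:: x; x] [::] [::] i1 e1 i2 e2 i3 e3
  = (if o x then 2 else 1)
    * strand_colourings o' [::] [::] [::] i1 e1 i2 e2 i3 e3.
Proof.
rewrite /strand_colourings /admissible /= /matched /= eqxx.
by case: (o x) i1 e1 i2 e2 i3 e3 => [] [] [] [] [] [] [].
Qed.

Definition bigon same (oc od : bool) : ends := 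
  strand_colourings (nth false [:: oc; od]) [:: 0; 1]
    (ordered same 0 1) [::].

Lemma bigonE (L : eqType) (o : L -> bool) c d same i1 e1 i2 e2 i3 e3 : c != d ->
  strand_colourings o [:: c; d] (ordered same c d) [::] i1 e1 i2 e2 i3 e3
  = bigon same (o c) (o d) i1 e1 i2 e2 i3 e3.
Proof.
move=> cd; pose h := nth c [:: c; d].
have -> : [:: c; d] = map h [:: 0; 1] by [].
have -> : ordered same c d = map h (ordered same 0 1) by case: same.
have sub : {subset [:: 0; 1] ++ ordered same 0 1 ++ [::] <= [:: 0; 1]}.
  by case: same => -[|[|k]].
apply: (@strand_colourings_map _ _ h o _ _ _ [::])
  => [k l /sub ks /sub ls /eqP|k /sub].
  rewrite nth_uniq //= ?inE ?cd //; first exact/eqP.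
  - by move: ks; rewrite !inE => /orP[] /eqP->.
  - by move: ls; rewrite !inE => /orP[] /eqP->.
by rewrite !inE => /orP[] /eqP->.
Qed.

(* The flags say whether the smoothing would respect orientations if all three
   strands were oriented like the ordering of their ends in which the top strand
   meets a first, the middle one a first and the bottom one b first; with this
   normalization the resulting pairing of the ends no longer depends on ot, om
   and ob. The smoothing [false true false] splits off a circle. *)
Definition triangle_strands ot om ob (xa xb xc : bool) : ends := 
  strand_colourings
   (nth false [:: xa == (ot == om); xb == (ot == ob); xc == (om == ob)])
   (ordered ot 0 1) (ordered om 0 2) (ordered ob 1 2).

Lemma triangle_strandsE (L : eqType) (o : L -> bool) a b c ot om ob
    i1 e1 i2 e2 i3 e3 : uniq [:: a; b; c] ->
  strand_colourings o (ordered ot a b) (ordered om a c) (ordered ob b c)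
    i1 e1 i2 e2 i3 e3
  = triangle_strands ot om ob (o a == (ot == om)) (o b == (ot == ob))
      (o c == (om == ob)) i1 e1 i2 e2 i3 e3.
Proof.
move=> abc; pose h := nth a [:: a; b; c].
have -> : ordered ot a b = map h (ordered ot 0 1) by case: ot.
have -> : ordered om a c = map h (ordered om 0 2) by case: om.
have -> : ordered ob b c = map h (ordered ob 1 2) by case: ob.
have sub : {subset ordered ot 0 1 ++ ordered om 0 2 ++ ordered ob 1 2
            <= [:: 0; 1; 2]}.
  by case: ot om ob => [] [] [] [|[|[|k]]].
apply: strand_colourings_map => [k l /sub ks /sub ls /eqP|k /sub].
  rewrite nth_uniq //; first exact/eqP.
  - by move: ks; rewrite !inE => /or3P[] /eqP->.
  - by move: ls; rewrite !inE => /or3P[] /eqP->.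
rewrite !inE => /or3P[] /eqP-> /=.
- by case: (o a) (ot == om) => [] [].
- by case: (o b) (ot == ob) => [] [].
- by case: (o c) (om == ob) => [] [].
Qed.

(** Here [l] and [r] are the triangle before and after the move. Three smoothings pair the ends
    alike on both sides. Four of the others share one pairing on each side, one of them with an
    extra circle, and the last, [true false true], has the pairing shared by those four on the
    opposite side. *)
Lemma triangle_strands_facts ot om ob i1 e1 i2 e2 i3 e3 :
  let l xa xb xc := triangle_strands ot om ob xa xb xc i1 e1 i2 e2 i3 e3 in
  let r xa xb xc :=
    triangle_strands (~~ ot) (~~ om) (~~ ob) xa xb xc i1 e1 i2 e2 i3 e3 in
  [/\ [/\ l false true true = l false false false,
          l true true false = l false false false,
          r true false true = l false false false
        & l false true false = 2 * l false false false],
      [/\ r false true true = r false false false,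
          r true true false = r false false false,
          l true false true = r false false false
        & r false true false = 2 * r false false false]
    & [/\ l false false true = r false false true,
          l true false false = r true false false
        & l true true true = r true true true]].
Proof.
by move: ot om ob i1 e1 i2 e2 i3 e3; do 9 case; vm_compute.
Qed.

(** One smoothing reconnects the strands as if there were no crossings; the other three share a
    pairing, and one of them splits off a circle. *)
Lemma bigon_facts same i1 e1 i2 e2 i3 e3 :
  let g oc od := bigon same oc od i1 e1 i2 e2 i3 e3 in
  [/\ g true false = g false true,
      g same same = strand_colourings (fun=> true) [::] [::] ([::] : seq nat)
                      i1 e1 i2 e2 i3 e3
    & g (~~ same) (~~ same) = 2 * g false true].
Proof. by move: same i1 e1 i2 e2 i3 e3; do 7 case; vm_compute. Qed.

(** * Reidemeister moves on arrowless words *)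

Section Moves.

Local Open Scope ring_scope.

Variables (K : fieldType) (A : K).
Hypothesis A0 : A != 0.

Local Notation letter := (nat * bool)%type.
Implicit Types (u v w x : seq letter) (s : letter -> bool).
Local Notation jones := (word_jones A).
Local Notation value := (state_value A).

Lemma placement_value pl ctx s s' T M B T' M' B' :
  placement pl ctx ->
  {in T ++ M ++ B, forall c, c \notin ctx} ->
  {in T' ++ M' ++ B', forall c, c \notin ctx} ->
  {in ctx, s =1 s'} ->
  (forall i1 e1 i2 e2 i3 e3,
     strand_colourings (orientation s) T M B i1 e1 i2 e2 i3 e3
     = strand_colourings (orientation s') T' M' B' i1 e1 i2 e2 i3 e3) ->
  value (pl T M B) s = value (pl T' M' B') s'.
Proof.
move=> [_ cut] d d' es eT; rewrite /state_value.
rewrite (cut _ (orientation s') 1%N T M B T' M' B') ?mul1n //.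
  by move=> c cx; rewrite /orientation es.
by move=> *; rewrite mul1n.
Qed.

(** A doubled count means one more circle, hence one more loop factor. *)
Lemma placement_value_double pl ctx s s' T M B T' M' B' :
  placement pl ctx ->
  {in T ++ M ++ B, forall c, c \notin ctx} ->
  {in T' ++ M' ++ B', forall c, c \notin ctx} ->
  {in ctx, s =1 s'} ->
  (forall i1 e1 i2 e2 i3 e3,
     strand_colourings (orientation s) T M B i1 e1 i2 e2 i3 e3
     = (2 * strand_colourings (orientation s') T' M' B' i1 e1 i2 e2 i3 e3)%N) ->
  value (pl T M B) s = (- A ^+ 2 - A ^- 2) * value (pl T' M' B') s'.
Proof.
move=> [_ cut] d d' es eT; rewrite /state_value.
rewrite (cut _ (orientation s') 2%N T M B T' M' B') //.
  by rewrite loop_value_double // colourings_gt0.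
by move=> c cx; rewrite /orientation es.
Qed.

Lemma word_jones_R1 u v c : c \notin u ++ v ->
  jones (u ++ v) = jones (u ++ [:: c; c] ++ v).
Proof.
move=> cuv; apply: (@word_jones_local K A A0 [::] [:: c] _ _ (undup (u ++ v))).
- by rewrite cats0.
- apply: uniq_perm; rewrite ?undup_uniq ?cats1 ?rcons_uniq ?mem_undup ?cuv //.
    by rewrite undup_uniq.
  move=> x; rewrite mem_undup mem_rcons inE !mem_cat mem_undup mem_cat !inE.
  by do 3 case: (_ == _) || case: (_ \in _).
move=> s /=; rewrite big_nil big_seq1 oppr0 expr0z mul1r.
(* The kink is the first strand; the other two strands are empty. *)
pose pl T M B : seq letter := u ++ T ++ v ++ M ++ [::] ++ B ++ [::].
have plP : placement pl (u ++ v ++ [::] ++ [::]) by exact: placement_id.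
have pl0 : u ++ v = pl [::] [::] [::] by rewrite /pl !cats0.
have pl1 : u ++ [:: c; c] ++ v = pl [:: c; c] [::] [::] by rewrite /pl !cats0.
have fresh : {in [:: c; c] ++ [::] ++ [::], forall d,
    d \notin u ++ v ++ [::] ++ [::]}.
  by move=> d; rewrite /= !inE !cats0 orbb => /eqP->.
have agree b : {in u ++ v ++ [::] ++ [::], update s c b =1 s}.
  by apply: update_notin; rewrite !cats0.
have v1 b : b = c.2 -> value (u ++ [:: c; c] ++ v) (update s c b)
                       = (- A ^+ 2 - A ^- 2) * value (u ++ v) s.
  move=> bc; rewrite pl0 pl1; apply: (placement_value_double plP) => // *.
  rewrite (kink_strands _ (orientation s)) /orientation update_id.
  by rewrite bc eqxx.
have v2 b : b = ~~ c.2 -> value (u ++ [:: c; c] ++ v) (update s c b)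
                       = value (u ++ v) s.
  move=> bc; rewrite pl0 pl1; apply: (placement_value plP) => // *.
  rewrite (kink_strands _ (orientation s)) /orientation update_id.
  by rewrite bc; case: c.2; rewrite mul1n.
(* The markers at the kink contribute [- A ^+ 3] if it is positive and [- A ^- 3] if it is negative,
   which the writhe factor cancels. *)
case: c.2 v1 v2 => v1 v2 /=.
  rewrite (v1 true) // (v2 false) // exprN1; field.
  by rewrite A0 oppr_eq0 expf_neq0.
rewrite (v1 false) // (v2 true) // opprK expr1z; field.
by rewrite A0.
Qed.

Lemma word_jones_R2 u v w c d same :
  c.2 = ~~ d.2 -> c \notin u ++ v ++ w -> d \notin u ++ v ++ w ->
  jones (u ++ v ++ w)
  = jones (u ++ [:: c; d] ++ v ++ ordered same c d ++ w).
Proof.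
move=> ecd cn dn.
have cd : c != d by apply: contra_eq_neq ecd => ->; case: d.2.
pose ctx := u ++ v ++ w.
apply: (@word_jones_local K A A0 [::] [:: c; d] _ _ (undup ctx)).
- by rewrite cats0.
- apply: uniq_perm; rewrite ?undup_uniq //.
    rewrite cat_uniq undup_uniq /= !mem_undup !inE cd.
    by rewrite (negbTE cn) (negbTE dn).
  move=> x; rewrite mem_undup !mem_cat mem_undup !mem_cat !inE.
  case: same; rewrite !inE;
  by case: (x \in u); case: (x \in v); case: (x \in w); case: (x == c);
    case: (x == d).
move=> s /=; rewrite big_nil !big_cons big_nil ecd.
have -> : - (pm (~~ d.2) + (pm d.2 + 0)) = 0 by case: d.2.
rewrite oppr0 !expr0z !mul1r.
pose pl T M B : seq letter := u ++ T ++ v ++ M ++ w ++ B ++ [::].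
have plP : placement pl (u ++ v ++ w ++ [::]) by exact: placement_id.
pose w' := pl [:: c; d] (ordered same c d) [::].
have -> : u ++ v ++ w = pl [::] [::] [::] by rewrite /pl !cats0.
have -> : u ++ c :: d :: v ++ ordered same c d ++ w = w'.
  by rewrite /w' /pl !cats0.
have fresh : {in [:: c; d] ++ ordered same c d ++ [::], forall e,
    e \notin u ++ v ++ w ++ [::]}.
  move=> e; rewrite !cats0 => ee.
  have : e \in [:: c; d].
    by move: ee; case: (same); rewrite mem_cat !inE => /orP[] /orP[] /eqP->;
       rewrite eqxx ?orbT.
  by rewrite !inE => /orP[] /eqP->.
(* The flags [oc] and [od] say whether the smoothings at [c] and [d] respect orientations. *)
pose st oc od := update (update s c (oc == c.2)) d (od == d.2).
have stE oc od i1 e1 i2 e2 i3 e3 :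
    strand_colourings (orientation (st oc od)) [:: c; d] (ordered same c d) [::]
      i1 e1 i2 e2 i3 e3 = bigon same oc od i1 e1 i2 e2 i3 e3.
  rewrite bigonE // /orientation /st update_id /update (negbTE cd) eqxx.
  by case: oc od c.2 d.2 => [] [] [] [].
have agree oc od : {in u ++ v ++ w ++ [::], st oc od =1 s}.
  move=> e; rewrite cats0 => ee; rewrite /st.
  by rewrite (update_notin _ _ dn) // (update_notin _ _ cn).
have agree' oc od : {in u ++ v ++ w ++ [::], st oc od =1 st false true}.
  by move=> e ee; rewrite !agree.
have v1 : value w' (st true false) = value w' (st false true).
  apply: (placement_value plP) => // i1 e1 i2 e2 i3 e3; rewrite !stE.
  by case: (bigon_facts same i1 e1 i2 e2 i3 e3).
have v2 : value w' (st same same) = value (pl [::] [::] [::]) s.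
  apply: (placement_value plP) => // i1 e1 i2 e2 i3 e3; rewrite !stE.
  by case: (bigon_facts same i1 e1 i2 e2 i3 e3) => _ ->.
have v3 : value w' (st (~~ same) (~~ same))
        = (- A ^+ 2 - A ^- 2) * value w' (st false true).
  apply: (placement_value_double plP) => // i1 e1 i2 e2 i3 e3; rewrite !stE.
  by case: (bigon_facts same i1 e1 i2 e2 i3 e3) => _ _ ->.
(* As the signs are opposite, the two smoothings with different flags have equal markers and weights
   [A ^+ 2] and [A ^- 2]. They cancel the loop factor of the smoothing with a circle, and the
   remaining one has weight 1. *)
rewrite -v2; move: v1 v3; rewrite /st {st stE agree agree' v2} ecd.
by case: (same); case: d.2; rewrite ?eqb_id ?eqbF_neg /= => -> ->; field;
  rewrite A0.
Qed.

(* [ka], [kb], [kc] tell which smoothings have the positive marker. The excluded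
   values are those of a triangle whose strands pass over each other cyclically,
   where the third move is not available. *)
Lemma word_jones_R3 pl ctx (a b c : letter) ot om ob ka kb kc :
  placement pl (ctx : seq letter) -> uniq [:: a; b; c] ->
  {in [:: a; b; c], forall e, e \notin ctx} ->
  [/\ a.2 = (ka == (ot == om)), b.2 = (kb == (ot == ob))
    & c.2 = (kc == (om == ob))] ->
  ~~ ((ka == kc) && (ka != kb)) ->
  jones (pl (ordered ot a b) (ordered om a c) (ordered ob b c)) =
  jones (pl (ordered (~~ ot) a b) (ordered (~~ om) a c) (ordered (~~ ob) b c)).
Proof.
move=> plP abc fresh [ea eb ec] k.
have mem_tri ot' om' ob' : ordered ot' a b ++ ordered om' a c ++ ordered ob' b c
    =i [:: a; b; c].
  move=> x; rewrite !mem_cat; case: ot' om' ob' => [] [] []; rewrite !inE;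
  by case: (x == a); case: (x == b); case: (x == c).
have uc : uniq (undup ctx ++ [:: a; b; c]).
  rewrite cat_uniq undup_uniq abc andbT /= !mem_undup.
  by rewrite !(negbTE (fresh _ _)) // !inE eqxx ?orbT.
have perm ot' om' ob' :
    perm_eq (undup (pl (ordered ot' a b) (ordered om' a c) (ordered ob' b c)))
            (undup ctx ++ [:: a; b; c]).
  apply: uniq_perm; rewrite ?undup_uniq // => x.
  rewrite mem_undup (perm_mem (plP.1 _ _ _)) !catA mem_cat -catA mem_tri.
  by rewrite mem_cat mem_undup orbC.
apply: (word_jones_local A0 (perm _ _ _) (perm _ _ _)) => s.
congr (_ * _).
have fresh' ot' om' ob' : {in ordered ot' a b ++ ordered om' a c
    ++ ordered ob' b c, forall e, e \notin ctx}.
  by move=> x; rewrite mem_tri; apply: fresh.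
(* The markers are chosen so that [xa], [xb], [xc] are the normalized flags of
   [triangle_strands]. *)
pose st xa xb xc :=
  update (update (update s a (xa == ka)) b (xb == kb)) c (xc == kc).
have agree xa xb xc : {in ctx, st xa xb xc =1 s}.
  move=> x xx; rewrite /st !(@update_notin _ _ _ _ ctx) //; apply: fresh;
  by rewrite !inE eqxx ?orbT.
have agree' xa xb xc xa' xb' xc' :
  {in ctx, st xa xb xc =1 st xa' xb' xc'} by move=> x xx; rewrite !agree.
case/and3P: (abc); rewrite !inE negb_or => /andP[nab nac] nbc _.
have sta xa xb xc : orientation (st xa xb xc) a = (xa == (ot == om)).
  rewrite /orientation /st /update eqxx (negbTE nab) (negbTE nac) ea.
  by case: xa (ka) (ot == om) => [] [] [].
have stb xa xb xc : orientation (st xa xb xc) b = (xb == (ot == ob)).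
  rewrite /orientation /st /update eqxx (negbTE nbc) eb.
  by case: xb (kb) (ot == ob) => [] [] [].
have stc xa xb xc : orientation (st xa xb xc) c = (xc == (om == ob)).
  rewrite /orientation /st /update eqxx ec.
  by case: xc (kc) (om == ob) => [] [] [].
have eqbK (x y : bool) : ((x == y) == y) = x by case: x y => [] [].
have stE xa xb xc i1 e1 i2 e2 i3 e3 :
    strand_colourings (orientation (st xa xb xc)) 
      (ordered ot a b) (ordered om a c) (ordered ob b c) i1 e1 i2 e2 i3 e3
    = triangle_strands ot om ob xa xb xc i1 e1 i2 e2 i3 e3.
  by rewrite triangle_strandsE // sta stb stc !eqbK.
have stE' xa xb xc i1 e1 i2 e2 i3 e3 :
    strand_colourings (orientation (st xa xb xc)) (ordered (~~ ot) a b)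
      (ordered (~~ om) a c) (ordered (~~ ob) b c) i1 e1 i2 e2 i3 e3
    = triangle_strands (~~ ot) (~~ om) (~~ ob) xa xb xc i1 e1 i2 e2 i3 e3.
  rewrite triangle_strandsE // sta stb stc !(inj_eq negb_inj).
  by rewrite !eqbK.
pose l xa xb xc := value (pl (ordered ot a b) (ordered om a c) (ordered ob b c))
  (st xa xb xc).
pose r xa xb xc := value (pl (ordered (~~ ot) a b) (ordered (~~ om) a c)
  (ordered (~~ ob) b c)) (st xa xb xc).
have [[l1 l2 l3 l4] [r1 r2 r3 r4] [lr1 lr2 lr3]] :
  [/\ [/\ l false true true = l false false false,
          l true true false = l false false false,
          r true false true = l false false false
        & l false true false = (- A ^+ 2 - A ^- 2) * l false false false],
      [/\ r false true true = r false false false,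
          r true true false = r false false false,
          l true false true = r false false false
        & r false true false = (- A ^+ 2 - A ^- 2) * r false false false]
    & [/\ l false false true = r false false true,
          l true false false = r true false false
        & l true true true = r true true true]].
  have facts := triangle_strands_facts ot om ob.
  by split; split;
    (apply: (placement_value plP) || apply: (placement_value_double plP))
      => // i1 e1 i2 e2 i3 e3;
    rewrite ?stE ?stE'; case: (facts i1 e1 i2 e2 i3 e3)
      => [[? ? ? ?] [? ? ? ?] [? ? ?]].
rewrite /= -!/(st _ _ _).
(* The four smoothings with a common pairing have the same total weight as [true false true], which
   has this pairing on the opposite side. This identity between weights fails for the values
   excluded by [k]. *)
move: l1 l2 l3 l4 r1 r2 r3 r4 lr1 lr2 lr3; rewrite /l /r /st.
by case: ka kb kc k {ea eb ec st agree agree' sta stb stc stE stE' l r}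
  => [] [] [] //= _ -> -> -> -> -> -> -> -> -> -> ->; field; rewrite A0.
Qed.

End Moves.

(** * Circles and colourings *)

Definition invariant_colouring (T : finType) (e : rel T)
    (f : {ffun T -> bool}) : bool :=
  [forall x, forall y, e x y ==> (f x == f y)].

(** An invariant colouring amounts to a free choice of colour at the root of each component other
    than that of [x0]. *)
Lemma card_invariant_colourings (T : finType) (e : rel T) (x0 : T) :
  symmetric e ->
  #|[set f : {ffun T -> bool} | ~~ f x0 & invariant_colouring e f]|
  = 2 ^ (n_comp e predT).-1.
Proof.
move=> sym; have csym : connect_sym e by exact: sym_connect_sym.
pose D := [pred z | (z \in fingraph.roots e) && (z != fingraph.root e x0)].
have cD : #|D| = (n_comp e predT).-1.
  rewrite [n_comp e _](cardD1 (fingraph.root e x0)) !inE roots_root //= add0n.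
  by apply: eq_card => z; rewrite !inE andbT andbC.
(* The free choices at the roots in [D] are encoded as functions equal to [false] off [D]; [h]
   spreads the colour of a root over its component. *)
pose Y : {set {ffun T -> bool}} := [set f in pffun_on false D predT].
have cY : #|Y| = 2 ^ (n_comp e predT).-1.
  by rewrite cardsE card_pffun_on cD card_bool.
pose h (f : {ffun T -> bool}) : {ffun T -> bool} :=
  [ffun z => f (fingraph.root e z)].
rewrite -cY -(@card_in_imset _ _ h Y); last first.
  move=> f f'; rewrite !inE => /pffun_onP[sf _] /pffun_onP[sf' _] /ffunP ef.
  apply/ffunP=> z; have [zD|zD] := boolP (z \in D).
    by move: zD (ef z); rewrite !inE => /andP[/eqP rz _]; rewrite !ffunE rz.
  have out g : (false.-support g \subset D) -> g z = false.
    by move/subsetP/(_ z); rewrite (negbTE zD) !inE; case: (g z) => // ->.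
  by rewrite !out.
apply: eq_card => f; rewrite inE; apply/andP/imsetP; last first.
  case=> g; rewrite inE => /pffun_onP[/subsetP sg _] ->; split.
    rewrite ffunE; apply/negP => g0; have := sg (fingraph.root e x0).
    by rewrite !inE g0 eqxx andbF => /(_ isT).
  apply/forallP=> x; apply/forallP=> y; apply/implyP=> exy.
  by rewrite !ffunE (fingraph.rootP csym (connect1 exy)).
case=> f0 /forallP inv.
have fr z : f (fingraph.root e z) = f z.
  have /connectP[p ep ->] := connect_root e z.
  elim: p z ep => //= y p IH z /andP[ezy /IH ->].
  by have /forallP/(_ y)/implyP/(_ ezy)/eqP := inv z.
exists [ffun z => (z \in D) && f z].
  rewrite inE; apply/pffun_onP; split=> //.
  by apply/subsetP=> z; rewrite supportE ffunE; case: (z \in D).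
apply/ffunP=> z; rewrite !ffunE !inE roots_root //= fr.
by case: eqP => //= ez; rewrite -fr ez fr (negbTE f0).
Qed.

(** The leaving arcs have the colours [t]; the entering arcs have the same colours shifted by one
    place, starting with [b]. *)
Lemma colour_sum_tuple (L : eqType) n (w : seq L) b F : size w = n ->
  colour_sum w b F
  = \sum_(t : n.-tuple bool) F (zip w (zip (b :: t) t)) (last b t).
Proof.
elim: n w b F => [|n IH] [|x w] b F //= => [_|[sw]].
  by rewrite (big_pred1 [tuple]) // => t; rewrite [t]tuple0; apply/esym/eqP.
have bij : {on [pred _ | true], bijective 
    (fun p : bool * n.-tuple bool => [tuple of p.1 :: p.2])}.
  exists (fun t => (thead t, [tuple of behead t])) => [[c t] _|t _] /=.
    by congr pair; apply/val_inj.
  by rewrite [RHS]tuple_eta.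
rewrite (reindex _ bij) /=.
rewrite -(pair_big predT predT (fun c (t : n.-tuple bool) =>
   F ((x, (b, c)) :: zip w (zip (c :: t) t)) (last c t))) /=.
by rewrite big_bool addnC !IH.
Qed.

(** * Agreement of the word state sum with the Jones polynomial *)

Section JonesWord.

Variable G : gauss_diagram.
Let w := map fst G.
Let n := size G.

Lemma size_word : size w = n. Proof. exact: size_map. Qed.

Definition glue (s : state G) : rel (gauss_arc G) :=
  [rel x y | glued s x y || glued s y x].

Section State.

Variable s : nat * bool -> bool.
Let s' : state G := [ffun c : crossing G => s (val c)].

(** Arc 0 gets the base colour [false], and arc k + 1, which leaves endpoint k, gets entry k of
    [t]. *)
Definition arc_colouring (t : n.-tuple bool) : {ffun gauss_arc G -> bool} :=
  [ffun k : 'I_n.+1 => nth false (false :: t) k].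

Lemma crossing_atE x0 (k : 'I_n) : crossing_at k = nth x0 w k.
Proof.
by rewrite /crossing_at (tnth_nth (x0, true)) /w (nth_map (x0, true)).
Qed.

(** The gluing at the base point accounts for the condition on the last colour, the gluings at
    crossings for [compatible]. *)
Lemma invariant_arc_colouring (t : n.-tuple bool) :
  invariant_colouring (glue s') (arc_colouring t)
  = ~~ last false t
    && admissible (orientation s) (zip w (zip (false :: t) t)).
Proof.
pose x0 := (0, false); pose c k := nth false (false :: t) k.
have st : size t = n by rewrite size_tuple.
have sz : size (zip w (zip (false :: t) t)) = n.
  rewrite !size_zip /= size_word st; lia.
have entry k : k < n -> nth (x0, (false, false)) (zip w (zip (false :: t) t)) k
                       = (nth x0 w k, (c k, c k.+1)).
  move=> kn; rewrite nth_zip_cond sz kn nth_zip_cond.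
  by rewrite size_zip /= st (_ : k < minn n.+1 n); last by lia.
have lastE : last false t = c n by rewrite (last_nth false) st.
have compat k l :
   (forall x y, glue s' x y -> arc_colouring t x = arc_colouring t y)
   -> k < l -> l < n -> nth x0 w k = nth x0 w l ->
   compatible (orientation s (nth x0 w k)) (c k, c k.+1) (c l, c l.+1).
  move=> inv kl ln ekl; have kn : k < n by apply: ltn_trans ln.
  have cw : nth x0 w k \in map fst G by rewrite mem_nth // size_word.
  pose cr : crossing G := SeqSub cw.
  have gl (k' l' : nat) (x y : gauss_arc G) : k' < n -> l' < n -> k' != l' ->
      nth x0 w k' = nth x0 w k -> nth x0 w l' = nth x0 w k ->
      glued_at (orientation s (nth x0 w k)) k' l' x y -> c x = c y.
    move=> k'n l'n nkl' ek el gxy.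
    have := inv x y; rewrite /arc_colouring !ffunE; apply.
    rewrite /glue /= /glued; apply/orP; left; apply/orP; right.
    apply/existsP; exists cr; apply/existsP; exists (Ordinal k'n).
    apply/existsP; exists (Ordinal l'n); rewrite !(crossing_atE x0) /=.
    by rewrite ek el !eqxx /= -val_eqE /= nkl' ffunE.
  have nkl : k != l by rewrite ltn_eqF.
  have arc j : j < n.+1 -> exists x : gauss_arc G, val x = j.
    by move=> jn; exists (Ordinal jn).
  have [xk ek] := arc k (ltnW kn); have [xk1 ek1] := arc k.+1 kn.
  have [xl el] := arc l (ltnW ln); have [xl1 el1] := arc l.+1 ln.
  rewrite /compatible; case: orientation gl => gl /=.
    have := gl k l xk xl1 kn ln nkl erefl (esym ekl).
    have := gl l k xl xk1 ln kn.
    rewrite eq_sym nkl => /(_ isT (esym ekl) erefl).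
    rewrite /= ek ek1 el el1 !eqxx => /(_ isT) -> /(_ isT) ->.
    by rewrite !eqxx.
  have := gl k l xk xl kn ln nkl erefl (esym ekl).
  have := gl k l xk1 xl1 kn ln nkl erefl (esym ekl).
  rewrite /= ek ek1 el el1 !eqxx orbT => /(_ isT) -> /(_ isT) ->.
  by rewrite !eqxx.
apply/idP/andP => [/forallP inv|[t0 adm]].
  have {}inv x y : glue s' x y -> arc_colouring t x = arc_colouring t y.
    by move=> gxy; have /forallP/(_ y)/implyP/(_ gxy)/eqP := inv x.
  split.
    have := inv ord0 ord_max; rewrite /glue /= /glued !eqxx /= => /(_ isT).
    by rewrite !ffunE lastE /= => e0; rewrite /c -[nth _ _ _]e0.
  apply/(pairwiseP (x0, (false, false))) => k l; rewrite !inE sz => kn ln kl.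
  rewrite /matched !entry //=; apply/implyP => /eqP; exact: compat.
have gl x y : glued s' x y -> arc_colouring t x = arc_colouring t y.
  rewrite /glued => /orP[/andP[/eqP-> /eqP->]|].
    by rewrite !ffunE /= -[LHS](negbTE t0) lastE.
  case/existsP=> cr /existsP[k /existsP[l /and4P[nkl]]].
  rewrite !(crossing_atE x0) => /eqP ek /eqP el.
  have cmp : compatible (orientation s (val cr)) (c k, c k.+1) (c l, c l.+1).
    have mt i j : i < j -> j < n ->
       nth x0 w i = val cr -> nth x0 w j = val cr ->
       compatible (orientation s (val cr)) (c i, c i.+1) (c j, c j.+1).
      move=> ij jn ei ej.
      have := pairwiseP (x0, (false, false)) adm i j; rewrite !inE sz.
      move=> /(_ (ltn_trans ij jn) jn ij); rewrite /matched !entry //.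
        by rewrite ei ej eqxx.
      exact: ltn_trans jn.
    (* [glued] takes the endpoints of a crossing in either order, [pairwise] only in increasing
       order; [compatible] is symmetric. *)
    case: (ltngtP k l) => [kl|lk|/val_inj kl].
    - exact: mt.
    - have := mt _ _ lk (ltn_ord k) el ek; rewrite /compatible /=.
      by case: orientation; rewrite !(eq_sym (c l)) !(eq_sym (c l.+1)) andbC.
    - by rewrite kl eqxx in nkl.
  rewrite ffunE -/(orientation s (val cr)) !ffunE -!/(c _).
  move: cmp; rewrite /compatible /glued_at; case: orientation => /=.
    by move=> /andP[/eqP e1 /eqP e2] /andP[/eqP -> /eqP ->].
  by move=> /andP[/eqP e1 /eqP e2] /orP[] /andP[/eqP -> /eqP ->].
apply/forallP=> x; apply/forallP=> y; apply/implyP=> /orP[/gl ->|/gl ->] //.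
Qed.

Lemma colourings_circles :
  colourings (orientation s) w = 2 ^ (circles s').-1.
Proof.
have sym : symmetric (glue s') by move=> x y; rewrite /glue /= orbC.
rewrite -(card_invariant_colourings ord0 sym) /colourings.
rewrite (colour_sum_tuple _ _ size_word) -sum1dep_card.
(* An invariant colouring that is [false] on arc 0 is recovered from the colours of the other
   arcs. *)
rewrite (reindex_onto arc_colouring
  (fun f => [tuple f (lift ord0 k) | k < n])) /=; last first.
  move=> f /andP[f0 _]; apply/ffunP=> k; rewrite ffunE.
  case: (unliftP ord0 k) => [j ->|->]; last by rewrite /= (negbTE f0).
  rewrite lift0 -[LHS]/(nth false [tuple f (lift ord0 k) | k < n] j).
  by rewrite -tnth_nth tnth_mktuple.
rewrite [RHS]big_mkcond /=; apply: eq_bigr => t _.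
rewrite ffunE /= -invariant_arc_colouring.
have -> : [tuple arc_colouring t (lift ord0 k) | k < n] = t.
  by apply: eq_from_tnth => k; rewrite tnth_mktuple ffunE lift0 /= -tnth_nth.
by rewrite eqxx andbT; case: invariant_colouring.
Qed.

End State.

Local Open Scope ring_scope.

Lemma enum_crossings : perm_eq (map val (enum (crossing G))) (undup w).
Proof.
apply: uniq_perm; rewrite ?undup_uniq ?(map_inj_uniq val_inj) ?enum_uniq //.
move=> c; rewrite mem_undup; apply/mapP/idP => [[x _ ->]|cw].
  exact: ssvalP.
by exists (SeqSub cw); rewrite ?mem_enum.
Qed.

Lemma state_sum_ffun (K : fieldType) (A : K) (T : finType) (C : seq T)
    (F : {ffun T -> bool} -> K) s : A != 0 -> uniq C ->
  state_sum A C (fun s => F (finfun s)) s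
  = \sum_(f : {ffun T -> bool} | [forall x, (x \notin C) ==> (f x == s x)])
      A ^ (\sum_(c <- C) pm (f c)) * F f.
Proof.
move=> A0; elim: C s => /= [|c C IH] s uC.
  rewrite (big_pred1 (finfun s)); first by rewrite big_nil expr0z mul1r.
  move=> f; apply/forallP/eqP => [ef|-> x]; last by rewrite ffunE.
  by apply/ffunP=> x; rewrite ffunE; apply/eqP; exact: ef.
case/andP: uC => cC uC.
rewrite !IH // [RHS](bigID (fun f : {ffun _} => f c)) /=.
have split b : (if b then A else A^-1) * (\sum_(f : {ffun T -> bool} |
      [forall x, (x \notin C) ==> (f x == update s c b x)])
        A ^ (\sum_(d <- C) pm (f d)) * F f)
  = \sum_(f : {ffun T -> bool} |
      [forall x, (x \notin c :: C) ==> (f x == s x)] && (f c == b))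
        A ^ (\sum_(d <- c :: C) pm (f d)) * F f.
  rewrite big_distrr /=; apply: eq_big => [f|f /forallP/(_ c)].
    apply/forallP/andP => [ef|[/forallP ef /eqP fc] x].
      split; last by have := ef c; rewrite cC update_id.
      apply/forallP=> x; rewrite inE negb_or; apply/implyP=> /andP[xc xC].
      by have := ef x; rewrite xC /update (negbTE xc).
    apply/implyP=> xC; rewrite /update.
    case: (eqVneq x c) => [->|xc]; first exact/eqP.
    by have := ef x; rewrite inE negb_or xC xc.
  rewrite cC update_id /= => /eqP fc.
  rewrite big_cons fc expfzDr // mulrA; congr (_ * _ * _).
  by case: b {fc}.
rewrite (split true) (split false); congr (_ + _); apply: eq_bigl => f;
  by case: (f c).
Qed.

(** By [colourings_circles], [logn 2] of the number of colourings is the exponent of the loop factor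
    in the Jones polynomial. *)
Lemma jones_word : jones G = word_jones A w.
Proof.
have A0 : A != 0 by rewrite invr_eq0 tofrac_eq0 polyX_eq0.
have ext := @state_value_extensional _ A w.
rewrite /jones /word_jones /word_writhe /writhe; congr (_ ^ (- _) * _).
  rewrite -(perm_big _ enum_crossings) /= big_map big_enum /=.
  exact: eq_bigr.
rewrite -(state_sum_perm A _ ext _ enum_crossings); last first.
  by rewrite (map_inj_uniq val_inj) enum_uniq.
pose F (f : state G) := (- A ^+ 2 - A ^- 2) ^+ (circles f).-1.
have extF : extensional (fun s : crossing G -> bool => F (finfun s)).
  by move=> s s' e; congr F; apply/ffunP=> x; rewrite !ffunE.
rewrite (eq_state_sum A _ _ (Phi' := fun s => F (finfun (s \o val)))).
  rewrite (state_sum_map A _ _ val_inj extF) state_sum_ffun ?enum_uniq //.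
  apply: eq_big => [f|f _].
    by apply/esym/forallP=> x; rewrite mem_enum.
  by rewrite /sigma big_enum.
by move=> s; rewrite /state_value /loop_value colourings_circles pfactorK.
Qed.

End JonesWord.

(** * Descending diagrams *)

Lemma perm_eq2P (T : eqType) (p q x y : T) : perm_eq [:: p; q] [:: x; y] ->
  (p, q) = (x, y) \/ (p, q) = (y, x).
Proof.
move=> e; have : p \in [:: x; y] by rewrite -(perm_mem e) mem_head.
rewrite !inE => /orP[] /eqP ep; rewrite ep in e *.
  by left; move: e; rewrite perm_cons => /(@perm_small_eq _ _ [:: y] isT) [->].
right; move: e; rewrite perm_sym (perm_catC [:: x] [:: y]) perm_sym perm_cons.
by move=> /(@perm_small_eq _ _ [:: x] isT) [->].
Qed.

Lemma perm_eq3P (T : eqType) (p q r x y z : T) :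
  perm_eq [:: p; q; r] [:: x; y; z] ->
  (p, q, r) \in [:: (x, y, z); (x, z, y); (y, x, z); (y, z, x); (z, x, y);
                    (z, y, x)].
Proof.
move=> e; have : p \in [:: x; y; z] by rewrite -(perm_mem e) mem_head.
rewrite !inE => /or3P[] /eqP ep; rewrite ep in e *.
- by move: e; rewrite perm_cons => /perm_eq2P[] [-> ->]; rewrite eqxx ?orbT.
- move: e; rewrite perm_sym (perm_catCA [:: x] [:: y] [:: z]) perm_sym.
  by rewrite perm_cons => /perm_eq2P[] [-> ->]; rewrite eqxx ?orbT.
move: e; rewrite perm_sym (perm_catCA [:: x; y] [:: z] [::]) perm_sym perm_cons.
by move=> /perm_eq2P[] [-> ->]; rewrite eqxx ?orbT.
Qed.

Definition named (m : nat) : pred endpoint := fun y => name y == m.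

Definition first_over (w : seq endpoint) (m : nat) : bool :=
  head false (map is_over (filter (named m) w)).

(** The table [t] of chords first met along the upper strand is a parameter because a piece of a
    word is relabelled according to the whole word. *)
Definition descending_letter (t : nat -> bool) (y : endpoint) : nat * bool :=
  (name y, positive y == t (name y)).

Definition descending_word (w : seq endpoint) : seq (nat * bool) :=
  map (descending_letter (first_over w)) w.

(* i o p records the signs of the crossings after the crossing changes which
   make the diagram descending: a crossing changes sign exactly when it is met
   first along the lower strand. *)
Lemma ip_wordE w : i_word (p_word w) = descending_word w.
Proof.
rewrite /i_word /p_word -map_comp; apply/eq_in_map => x xw /=.
congr pair; rewrite /p_label.
have -> : is_over (first_endpoint w x) = first_over w (name x).
  rewrite /first_endpoint /first_over /named; elim: w xw => //= y w IH.
  rewrite inE; case: (eqVneq x y) => [->|_ /IH]; first by rewrite eqxx.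
  by case: (eqVneq (name y)).
by case: positive; case: first_over.
Qed.

Lemma first_over_cat u v m : first_over (u ++ v) m =
  if has (named m) u then first_over u m else first_over v m.
Proof.
rewrite /first_over filter_cat map_cat has_filter.
by case: filter.
Qed.

(** Gives the freshness and distinctness of the chords in a move: the endpoints that the move
    displays already exhaust the count. *)
Lemma count_named w m : gauss_wf w -> has (named m) w -> count (named m) w = 2.
Proof.
move=> /andP[/allP wf _] /hasP[x xw /eqP <-].
have /andP[/eqP + _] := wf _ (map_f fst xw).
by rewrite count_map.
Qed.

Lemma descending_notin t c w : ~~ has (named c.1) w ->
  c \notin map (descending_letter t) w.
Proof.
by apply: contra => /mapP[y yw ->]; apply/hasP; exists y => //=; rewrite /named.
Qed.

Lemma eq_descending t t' w : (forall m, has (named m) w -> t m = t' m) ->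
  map (descending_letter t) w = map (descending_letter t') w.
Proof.
move=> e; apply/eq_in_map => y yw; rewrite /descending_letter e //.
by apply/hasP; exists y => //; rewrite /named.
Qed.

(** * Invariance under each Gauss diagram move *)

Local Notation invariant := (word_jones A).

Lemma A_neq0 : A != 0%R.
Proof. by rewrite invr_eq0 tofrac_eq0 polyX_eq0. Qed.

Lemma descending_renaming (f : nat -> nat) w : injective f ->
  invariant (descending_word w)
  = invariant (descending_word
      [seq ((f (name x), positive x), is_over x) | x <- w]).
Proof.
move=> fi; rewrite -(word_jones_map _ _ fi); congr word_jones.
rewrite /descending_word -!map_comp; apply/eq_map => y /=.
rewrite /descending_letter /=; congr (_, _ == _).
rewrite /first_over filter_map -map_comp; congr head.
under [in RHS]eq_filter => z do rewrite /named /name /= inj_eq //.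
exact: eq_map.
Qed.

Lemma descending_R1 u v c e o :
  gauss_wf (u ++ [:: ((c, e), o); ((c, e), ~~ o)] ++ v) ->
  invariant (descending_word (u ++ v))
  = invariant (descending_word (u ++ [:: ((c, e), o); ((c, e), ~~ o)] ++ v)).
Proof.
set k := [:: _; _] => wf; have := count_named (m := c) wf.
rewrite !has_cat !count_cat /= /named /= eqxx orbT => /(_ isT) uv0.
have uv : ~~ has (named c) (u ++ v) by rewrite has_count count_cat /named; lia.
pose t := descending_letter (first_over (u ++ k ++ v)).
pose x := t ((c, e), o).
have -> : descending_word (u ++ k ++ v) = map t u ++ [:: x; x] ++ map t v.
  by rewrite /descending_word !map_cat.
rewrite -(word_jones_R1 A_neq0) -?map_cat; last exact: descending_notin.
congr word_jones; apply: eq_descending => m hm.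
rewrite !first_over_cat; case: ifP => //; case: ifP => //=.
rewrite orbF orbb /named /= => /eqP ecm; by rewrite -ecm (negbTE uv) in hm.
Qed.

Lemma descending_R2 u v w c d e o same :
  gauss_wf (u ++ [:: ((c, e), o); ((d, ~~ e), o)]
    ++ v ++ in_order same ((c, e), ~~ o) ((d, ~~ e), ~~ o) ++ w) ->
  invariant (descending_word (u ++ v ++ w))
  = invariant (descending_word (u ++ [:: ((c, e), o); ((d, ~~ e), o)]
    ++ v ++ in_order same ((c, e), ~~ o) ((d, ~~ e), ~~ o) ++ w)).
Proof.
set w' := u ++ _ => wf.
have cnt m : count (named m) w' =
    count (named m) (u ++ v ++ w) + ((c == m) + (d == m)).*2.
  rewrite /w' !count_cat.
  by case: same {w' wf}; rewrite /= /named /name /=; lia.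
have has_m m : (c == m) || (d == m) -> has (named m) w'.
  by rewrite has_count cnt => /orP[] ->; lia.
have := count_named wf (has_m c _); have := count_named wf (has_m d _).
rewrite !cnt !eqxx orbT => /(_ isT) cd /(_ isT) cc.
have ncd : c != d by apply/negP => /eqP ecd; move: cd; rewrite ecd eqxx; lia.
have cn : ~~ has (named c) (u ++ v ++ w) by rewrite has_count; lia.
have dn : ~~ has (named d) (u ++ v ++ w) by rewrite has_count; lia.
(* Both chords are first met on the same strand of the bigon, so both signs are kept or both
   reversed, and they remain opposite. *)
have foc : first_over w' c = o.
  rewrite /w' first_over_cat; move: cn; rewrite !has_cat.
  by case: has => //= _; rewrite /first_over /= {1}/named eqxx.
have fod : first_over w' d = o.
  rewrite /w' first_over_cat; move: dn; rewrite !has_cat.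
  case: has => //= _.
  by rewrite /first_over /named /name /= (negbTE ncd) eqxx.
pose t := descending_letter (first_over w').
have -> : descending_word w' = map t u ++ [:: (c, e == o); (d, ~~ e == o)]
    ++ map t v ++ ordered same (c, e == o) (d, ~~ e == o) ++ map t w.
  rewrite /descending_word -/t /w' !map_cat /= {2 3}/t /descending_letter /=.
  rewrite /name /positive /= foc fod; congr (_ ++ _ :: _ :: _ ++ _ ++ _).
  by case: (same); rewrite /= /t /descending_letter /name /positive /= foc fod.
rewrite -(word_jones_R2 A_neq0) -?map_cat; first last.
- exact: descending_notin.
- exact: descending_notin.
- by case: e o {wf w' cnt has_m cd cc foc fod t} => [] [].
congr word_jones; apply: eq_descending => m hm.
have cm : (c == m) = false by apply: contraTF hm => /eqP <-.
have dm : (d == m) = false by apply: contraTF hm => /eqP <-.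
rewrite /w' /first_over !filter_cat.
by case: (same); rewrite /= /named /name /= cm dm.
Qed.

(** After the crossing changes the sign of [a] is [(d == t a) == (ot == om)], and similarly for [b]
    and [c]. The hypothesis on [t] rules out strands that pass over each other cyclically. *)
Lemma descending_triangle pl ctx t a b c d ot om ob :
  placement pl (map (descending_letter t) ctx) -> uniq [:: a; b; c] ->
  ~~ has (named a) ctx -> ~~ has (named b) ctx -> ~~ has (named c) ctx ->
  ~~ ((t a == t c) && (t a != t b)) ->
  let tri := triangle a b c d ot om ob in
  let s i := map (descending_letter t) (nth [::] tri i) in
  invariant (pl (s 0) (s 1) (s 2))
  = invariant (pl (rev (s 0)) (rev (s 1)) (rev (s 2))).
Proof.
move=> plP abc an bn cn k tri s.
pose a' := (a, (d == (ot == om)) == t a).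
pose b' := (b, (d == (ot == ob)) == t b).
pose c' := (c, (d == (om == ob)) == t c).
have -> : s 0 = ordered ot a' b' by rewrite /s /a' /b' /c' /=; case: (ot).
have -> : s 1 = ordered om a' c' by rewrite /s /a' /b' /c' /=; case: (om).
have -> : s 2 = ordered ob b' c' by rewrite /s /a' /b' /c' /=; case: (ob).
have r (h : bool) (x y : nat * bool) : rev (ordered h x y) = ordered (~~ h) x y.
  by case: h.
rewrite !r; apply: (@word_jones_R3 _ _ A_neq0 pl _ a' b' c' ot om ob
  (d == t a) (d == t b) (d == t c) plP).
- move: abc; rewrite /= !inE !negb_or !xpair_eqE => /and3P[/andP[ab ac] bc _].
  by rewrite (negbTE ab) (negbTE ac) (negbTE bc).
- by move=> e; rewrite !inE => /or3P[] /eqP->; apply: descending_notin.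
- rewrite /a' /b' /c' /=.
  by case: d (ot == om) (ot == ob) (om == ob) (t a) (t b) (t c)
    {k tri s a' b' c' r} => [] [] [] [] [] [] [].
by move: k; case: (d) (t a) (t b) (t c) => [] [] [] [].
Qed.

(** A strand of the triangle meets two different chords, so reversing it does not change the order
    of the endpoints of any one chord. *)
Lemma filter_rev_strand (h : bool) (y z : endpoint) m : name y != name z ->
  filter (named m) (rev (in_order h y z)) = filter (named m) (in_order h y z).
Proof.
move=> nyz; have : ~~ (named m y && named m z).
  by apply: contra nyz => /andP[/eqP-> /eqP->].
by case: h => /=; rewrite /rev /=; case: (named m y); case: (named m z).
Qed.

Lemma descending_R3 u v w x p q r a b c d ot om ob :
  perm_eq [:: p; q; r] (triangle a b c d ot om ob) ->
  gauss_wf (u ++ p ++ v ++ q ++ w ++ r ++ x) ->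
  invariant (descending_word (u ++ p ++ v ++ q ++ w ++ r ++ x))
  = invariant (descending_word
      (u ++ rev p ++ v ++ rev q ++ w ++ rev r ++ x)).
Proof.
set W := u ++ p ++ _; move=> pqr wf; pose ctx := u ++ v ++ w ++ x.
have cnt m : count (named m) W
    = count (named m) ctx + ((a == m) + (b == m) + (c == m)).*2.
  have e : perm_eq W (flatten [:: p; q; r] ++ ctx).
    by apply/permP=> P; rewrite /W /ctx /= !count_cat /=; lia.
  rewrite (permP e) count_cat (permP (perm_flatten pqr)).
  rewrite /triangle /= !count_cat /named.
  by case: (ot); case: (om); case: (ob); rewrite /= /name /=; lia.
have has_m m : [|| a == m, b == m | c == m] -> has (named m) W.
  by rewrite has_count cnt => /or3P[] ->; lia.
have := count_named wf (has_m a _); have := count_named wf (has_m b _).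
have := count_named wf (has_m c _).
rewrite !cnt !eqxx !orbT => /(_ isT) cc /(_ isT) cb /(_ isT) ca.
have ab : a != b by apply/negP => /eqP e; move: cb; rewrite e eqxx; lia.
have ac : a != c by apply/negP => /eqP e; move: cc; rewrite e eqxx; lia.
have bc : b != c by apply/negP => /eqP e; move: cc; rewrite e eqxx; lia.
have an : ~~ has (named a) ctx by rewrite has_count; lia.
have bn : ~~ has (named b) ctx by rewrite has_count; lia.
have cn : ~~ has (named c) ctx by rewrite has_count; lia.
have abc : uniq [:: a; b; c] by rewrite /= !inE negb_or ab ac bc.
have frev s : s \in triangle a b c d ot om ob -> forall m,
    filter (named m) (rev s) = filter (named m) s.
  by rewrite !inE => /or3P[] /eqP-> m; apply: filter_rev_strand.
have mem s : s \in [:: p; q; r] -> s \in triangle a b c d ot om ob.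
  by rewrite (perm_mem pqr).
have fo_rev m : first_over (u ++ rev p ++ v ++ rev q ++ w ++ rev r ++ x) m
              = first_over W m.
  by rewrite /first_over !filter_cat !frev // mem // !inE eqxx ?orbT.
pose t := first_over W.
have fo m : ~~ has (named m) ctx ->
    t m = head false (map is_over (filter (named m) (p ++ q ++ r))).
  rewrite /ctx !has_cat !negb_or !has_filter !negbK.
  move=> /and4P[/eqP eu /eqP ev /eqP ew /eqP ex].
  by rewrite /t /first_over !filter_cat eu ev ew ex cats0.
rewrite /descending_word (_ : map _ (u ++ rev p ++ _)
  = map (descending_letter t)
      (u ++ rev p ++ v ++ rev q ++ w ++ rev r ++ x)); last first.
  by apply: eq_descending => m _.
pose D := map (descending_letter t).
rewrite -/t -/D /W /D !map_cat !map_rev.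
pose pl T M B := D u ++ T ++ D v ++ M ++ D w ++ B ++ D x.
have plP : placement pl (D ctx).
  by rewrite /D /ctx !map_cat; exact: placement_id.
have tri pl' (plP' : placement pl' (D ctx)) :=
  @descending_triangle pl' ctx t a b c d ot om ob plP' abc an bn cn.
have names := (negbTE ab, negbTE ac, negbTE bc,
               eq_sym b a, eq_sym c a, eq_sym c b).
(* The line traverses the strands in a linear order. If [t a = t c], the middle strand comes between
   the other two, and then [t b] has the same value. *)
have order : ~~ ((t a == t c) && (t a != t b)).
  rewrite !fo //; have /perm_eq3P := pqr; rewrite !inE /named.
  by do 5?[case/orP]; case/eqP=> -> -> ->; rewrite !filter_cat;
    case: (ot); case: (om); case: (ob); rewrite /= /name /= ?names ?eqxx.
have /perm_eq3P := pqr; rewrite !inE.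
(* The six orders of the strands along the line are reduced to top, middle, bottom by permuting the
   arguments of the placement. *)
do 5?[case/orP]; case/eqP=> -> -> ->.
- exact: tri plP order.
- exact: tri (placementAC plP) order.
- exact: tri (placementCA plP) order.
- exact: tri (placementCA (placementAC plP)) order.
- exact: tri (placementAC (placementCA plP)) order.
- exact: tri (placementCA (placementAC (placementCA plP))) order.
Qed.

Lemma gauss_move_invariant w w' : gauss_move w w' ->
  gauss_wf w -> gauss_wf w' ->
  invariant (descending_word w) = invariant (descending_word w').
Proof.
case=> [f v fi|u v c e o|u v x c d e o same|u v x y p q r a b c d ot om ob pqr]
  wf wf'.
- exact: descending_renaming.
- exact: descending_R1.
- exact: descending_R2.
- exact: descending_R3 pqr wf.
Qed.

Lemma jones_descending (D G : gauss_diagram) :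
  forget_arrows G = map_i (map_p D) -> jones G = invariant (descending_word D).
Proof.
move=> /(congr1 (@chord_word _)) /= eG.
by rewrite jones_word eG ip_wordE.
Qed.

(* V_P, for P without arrows, is [jones G] for any G with arrows chosen on P. *)
Theorem theorem3p2 (D D' : gauss_diagram) :
  same_long_virtual_knot D D' ->
  forall G G' : gauss_diagram,
    forget_arrows G = map_i (map_p D) ->
    forget_arrows G' = map_i (map_p D') ->
    jones G = jones G'.
Proof.
move=> same G G' /jones_descending -> /jones_descending ->.
elim: same => {D D' G G'} [D D' mv|D|D D' _ -> //|D1 D2 D3 _ -> _ -> //] //.
by apply: gauss_move_invariant mv _ _; apply: gauss_wordP.
Qed.
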